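(* Define $\xi:\mathcal{P}(\overline{\mathbb{Q}})_{\mathrm{prim}}\to H^1(G,\mathcal{P}(\overline{\mathbb{Z}}))$ by sending $P$ to the class of the cocycle $f:\tau\mapsto\nu(q^\tau,q)$, where $q=(t,u)\in\overline{\mathbb{Z}}^2$ is any point with $Q_P(t,u)=1$ and $q^\tau=(t^\tau,u^\tau)$. Then there is an exact sequence $$1\to\mathcal{P}(\mathbb{Q})\oplus\mathcal{P}(\overline{\mathbb{Z}})\to\mathcal{P}(\overline{\mathbb{Q}})_{\mathrm{prim}}\xrightarrow{\xi}H^1(G,\mathcal{P}(\overline{\mathbb{Z}}))\xrightarrow{\psi}H^1(G,\mathcal{P}(\overline{\mathbb{Q}})_{\mathrm{prim}}),$$ where the first map is inclusion and $\psi$ is induced by the inclusion $\mathcal{P}(\overline{\mathbb{Z}})\subseteq\mathcal{P}(\overline{\mathbb{Q}})_{\mathrm{prim}}$.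
   Context: Let $\Delta$ be a fundamental discriminant, $\Delta = \sigma + 4m$ with $\sigma\in\{0,1\}$, $m\in\mathbb{Z}$, and $Q_0(x,y)=x^2+\sigma xy-my^2$. $G=\mathrm{Gal}(\overline{\mathbb{Q}}/\mathbb{Q})$ acts coordinatewise on points. For $R\subseteq\overline{\mathbb{Q}}$, $\mathcal{P}(R)=\{(x,y)\in R^2:Q_0(x,y)=1\}$, a group under $(x_1,y_1)\oplus(x_2,y_2)=(x_1x_2+my_1y_2,\;x_1y_2+x_2y_1+\sigma y_1y_2)$ with identity $(1,0)$; $\overline{\mathbb{Z}}$ is the ring of algebraic integers. $\operatorname{den}(\alpha)$ is the least positive integer $n$ with $n\alpha\in\overline{\mathbb{Z}}$; $N(\alpha)$ is the product of the roots of the minimal polynomial of $\alpha$ over $\mathbb{Q}$. $\mathcal{P}(\overline{\mathbb{Q}})_{\mathrm{prim}}$ is the set of $(x,y)\in\mathcal{P}(\overline{\mathbb{Q}})$ such that, with $A=\operatorname{den}(y)$: $Ax\in\overline{\mathbb{Z}}$; $\gcd(A^2N(y),A^2)=1=\gcd(A,\Delta)$; and, with $a$ the least positive integer satisfying $a\equiv(A^2N(y))^{-1}\pmod{A^2}$, the number $b=aA^2N(y)x/y$ (if $y\ne0$; $b=0$ if $y=0$) is a rational integer; it is a subgroup of $\mathcal{P}(\overline{\mathbb{Q}})$ containing $\mathcal{P}(\mathbb{Q})$ and $\mathcal{P}(\overline{\mathbb{Z}})$. For $P$ in it, the denominator is $A=\operatorname{den}(y)$, the ratio $\beta$ is the least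 non-negative integer $\equiv b\pmod{A^2}$, and $Q_P(t,u)=A^2t^2+(2\beta+\sigma)tu+\gamma u^2$ with $\gamma=Q_0(\beta,1)/A^2\in\mathbb{Z}$. For $q_1=(t_1,u_1)$, $q_2=(t_2,u_2)$ algebraic-integer solutions of $Q_P=1$, $\nu(q_2,q_1)=L_{q_1}\binom{t_2}{u_2}$ where $L_{q_1}=\begin{pmatrix}A^2t_1+(\beta+\sigma)u_1 & \beta t_1+\gamma u_1\\ -u_1 & t_1\end{pmatrix}$; this lies in $\mathcal{P}(\overline{\mathbb{Z}})$. $H^1(G,M)=Z^1(G,M)/B^1(G,M)$ with $Z^1$ the functions $f:G\to M$ satisfying $f(\tau\sigma)=\tau(f(\sigma))+f(\tau)$ and $B^1$ those of the form $\sigma\mapsto\sigma(a)-a$.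
   Formalization: In the definition of primitive points, A^2 N(y) is replaced by A^d N(y) with d the degree of y, and b need only be congruent mod A^2 to a rational integer; literally, P(Q) and P(Z-bar) would not be contained in it. P(Q)⊕P(Z-bar) is the internal sum. *)

(* Defs.v *)
From HB Require Import structures.
From mathcomp Require Import all_boot all_order all_algebra all_field.
From mathcomp Require Import boolp classical_sets functions.
From mathcomp Require Import ring.

Set Implicit Arguments.
Unset Strict Implicit.
Unset Printing Implicit Defensive.

Import Order.TTheory GRing.Theory Num.Theory.
Local Open Scope ring_scope.
Local Open Scope quotient_scope.

(* [algC] is an algebraic closure of Q. Every ring endomorphism of [algC] fixes
   Q and is bijective (see [algC_invaut]), so this is the absolute Galois group;
   its law is composition. *)
Notation absGal := {rmorphism algC -> algC}.

Section Subgroups.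
Variable M : zmodType.

Definition subgroup_of (S : {pred M}) (hS : zmod_closed S) : zmodClosed M :=
  HB.pack (S : M -> bool) (GRing.isZmodClosed.Build M S hS).

Record subgroup (S : zmodClosed M) :=
  Subgroup { subgroup_val : M; _ : subgroup_val \in S }.

HB.instance Definition _ (S : zmodClosed M) :=
  [isSub for @subgroup_val S].
HB.instance Definition _ (S : zmodClosed M) :=
  [Choice of subgroup S by <:].
HB.instance Definition _ (S : zmodClosed M) :=
  [SubChoice_isSubZmodule of subgroup S by <:].

Definition incl (S T : zmodClosed M) (sST : {subset S <= T}) (x : subgroup S) :
  subgroup T := Subgroup (sST _ (valP x)).

Lemma incl_is_zmod_morphism (S T : zmodClosed M) (sST : {subset S <= T}) :
  zmod_morphism (incl sST).
Proof. by move=> x y; apply: val_inj; rewrite [RHS]raddfB. Qed.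
HB.instance Definition _ (S T : zmodClosed M) (sST : {subset S <= T}) :=
  GRing.isZmodMorphism.Build (subgroup S) (subgroup T) (incl sST)
    (incl_is_zmod_morphism sST).

Definition in_sum (S T : zmodClosed M) : {pred M} :=
  fun z => `[< exists x y, [/\ x \in S, y \in T & z = x + y] >].

Lemma in_sum_zmod_closed (S T : zmodClosed M) : zmod_closed (in_sum S T).
Proof.
split=> [|z1 z2 /asboolP[x1 [y1 [x1S y1T ->]]] /asboolP[x2 [y2 [x2S y2T ->]]]].
  by apply/asboolP; exists 0, 0; rewrite !rpred0 addr0.
apply/asboolP; exists (x1 - x2), (y1 - y2).
by rewrite !rpredB // opprD addrACA.
Qed.

Definition sumgroup (S T : zmodClosed M) : zmodClosed M :=
  subgroup_of (in_sum_zmod_closed S T).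

End Subgroups.

Definition exact_at (L M N : zmodType) (f : L -> M) (g : M -> N) : Prop :=
  forall y : M, g y = 0 <-> exists x : L, f x = y.

(* M is an abelian group on which the Galois group acts, S a subgroup.  Cocycles
   carry no continuity condition: absGal is taken as an abstract group. *)
Section Cohomology.
Variables (M : zmodType) (act : absGal -> {additive M -> M}).

Definition is_cocycle (S : zmodClosed M) : {pred absGal -> M} := fun f =>
  `[< (forall tau, f tau \in S) /\
      (forall tau rho : absGal, f (tau \o rho) = act tau (f rho) + f tau) >].

Lemma is_cocycle_zmod_closed (S : zmodClosed M) : zmod_closed (is_cocycle S).
Proof.
split=> [|f g /asboolP[fS fZ] /asboolP[gS gZ]]; apply/asboolP.
  split=> [tau|tau rho]; first exact: rpred0.
  by rewrite -[RHS]/(act tau 0 + 0) raddf0 addr0.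
split=> [tau|tau rho]; first exact: rpredB.
rewrite -[LHS]/(f (tau \o rho) - g (tau \o rho)).
rewrite -[RHS]/(act tau (f rho - g rho) + (f tau - g tau)).
by rewrite fZ gZ raddfB opprD addrACA.
Qed.

Definition Z1 (S : zmodClosed M) : zmodType :=
  subgroup (subgroup_of (is_cocycle_zmod_closed S)).

Definition is_coboundary (S : zmodClosed M) : {pred Z1 S} := fun f =>
  `[< exists2 a, a \in S & forall tau, val f tau = act tau a - a >].

Lemma is_coboundary_zmod_closed (S : zmodClosed M) :
  zmod_closed (@is_coboundary S).
Proof.
split=> [|f g /asboolP[a aS fa] /asboolP[b bS gb]]; apply/asboolP.
  by exists 0 => [|tau]; rewrite ?rpred0 // raddf0 subrr.
exists (a - b) => [|tau]; first exact: rpredB.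
rewrite -[LHS]/(val f tau - val g tau) fa gb (raddfB (act tau)).
by rewrite !opprD !opprK addrACA.
Qed.

Definition B1 (S : zmodClosed M) : zmodClosed (Z1 S) :=
  subgroup_of (@is_coboundary_zmod_closed S).

Definition H1 (S : zmodClosed M) : zmodType := Quotient.quot (B1 S).

Definition class_of (S : zmodClosed M) (f : Z1 S) : H1 S :=
  \pi_(Quotient.quot (B1 S)) f.

Lemma class_of_is_zmod_morphism (S : zmodClosed M) :
  zmod_morphism (@class_of S).
Proof. by move=> f g; rewrite /class_of raddfB. Qed.
HB.instance Definition _ (S : zmodClosed M) :=
  GRing.isZmodMorphism.Build (Z1 S) (H1 S) (@class_of S)
    (@class_of_is_zmod_morphism S).

Lemma incl_cocycle (S T : zmodClosed M) (sST : {subset S <= T}) :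
  {subset subgroup_of (is_cocycle_zmod_closed S)
       <= subgroup_of (is_cocycle_zmod_closed T)}.
Proof.
by move=> f /asboolP[fS fZ]; apply/asboolP; split=> // tau; apply: sST.
Qed.

Definition Z1_incl (S T : zmodClosed M) (sST : {subset S <= T}) :
  {additive Z1 S -> Z1 T} := incl (incl_cocycle sST).

Definition H1_incl (S T : zmodClosed M) (sST : {subset S <= T}) (c : H1 S) :
  H1 T := class_of (Z1_incl sST (repr c)).

Lemma H1_inclE (S T : zmodClosed M) (sST : {subset S <= T}) (f : Z1 S) :
  H1_incl sST (class_of f) = class_of (Z1_incl sST f).
Proof.
apply/eqP; rewrite -Quotient.idealrBE; apply/asboolP.
have: repr (class_of f) - f \in B1 S by rewrite Quotient.idealrBE reprK.
case/asboolP=> a aS fa; exists a; [exact: sST | exact: fa].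
Qed.

Lemma H1_incl_is_zmod_morphism (S T : zmodClosed M) (sST : {subset S <= T}) :
  zmod_morphism (H1_incl sST).
Proof.
elim/quotW=> f; elim/quotW=> g; rewrite -raddfB.
by rewrite !H1_inclE !raddfB.
Qed.
HB.instance Definition _ (S T : zmodClosed M) (sST : {subset S <= T}) :=
  GRing.isZmodMorphism.Build (H1 S) (H1 T) (H1_incl sST)
    (H1_incl_is_zmod_morphism sST).

End Cohomology.

Section Pell.
Variables sigma m : int.

Definition Q0 (x y : algC) : algC :=
  x ^+ 2 + sigma%:~R * x * y - m%:~R * y ^+ 2.

Record pell := Pell { coords : algC * algC; _ : Q0 coords.1 coords.2 == 1 }.

HB.instance Definition _ := [isSub for coords].
HB.instance Definition _ := [Choice of pell by <:].

Lemma pellP (P : pell) : Q0 (coords P).1 (coords P).2 = 1.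
Proof. exact/eqP/(valP P). Qed.

Definition coords_add (p q : algC * algC) : algC * algC :=
  (p.1 * q.1 + m%:~R * p.2 * q.2, p.1 * q.2 + q.1 * p.2 + sigma%:~R * p.2 * q.2).

(* conjugation of x + y omega, where omega ^ 2 = sigma * omega + m *)
Definition coords_opp (p : algC * algC) : algC * algC :=
  (p.1 + sigma%:~R * p.2, - p.2).

Definition coords_act (tau : absGal) (p : algC * algC) : algC * algC :=
  (tau p.1, tau p.2).

Lemma Q0_add p q : Q0 (coords_add p q).1 (coords_add p q).2 =
  Q0 p.1 p.2 * Q0 q.1 q.2.
Proof. by rewrite /Q0 /=; ring. Qed.

Lemma Q0_opp p : Q0 (coords_opp p).1 (coords_opp p).2 = Q0 p.1 p.2.
Proof. by rewrite /Q0 /=; ring. Qed.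

Lemma Q0_act tau p :
  Q0 (coords_act tau p).1 (coords_act tau p).2 = tau (Q0 p.1 p.2).
Proof.
by rewrite /Q0 /= !(rmorphB, rmorphD, rmorphM, rmorphXn, rmorph_int).
Qed.

Fact pell_zero_subproof :
  let p := (1, 0) : algC * algC in Q0 p.1 p.2 == 1.
Proof. by apply/eqP; rewrite /Q0 /=; ring. Qed.
Definition pell_zero : pell := Pell pell_zero_subproof.

Fact pell_add_subproof (P Q : pell) :
  let p := coords_add (coords P) (coords Q) in Q0 p.1 p.2 == 1.
Proof. by rewrite /= Q0_add !pellP mulr1. Qed.
Definition pell_add (P Q : pell) : pell := Pell (pell_add_subproof P Q).

Fact pell_opp_subproof (P : pell) :
  let p := coords_opp (coords P) in Q0 p.1 p.2 == 1.
Proof. by rewrite /= Q0_opp pellP. Qed.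
Definition pell_opp (P : pell) : pell := Pell (pell_opp_subproof P).

Fact pell_act_subproof (tau : absGal) (P : pell) :
  let p := coords_act tau (coords P) in Q0 p.1 p.2 == 1.
Proof. by rewrite /= Q0_act pellP rmorph1. Qed.
Definition pell_act (tau : absGal) (P : pell) : pell :=
  Pell (pell_act_subproof tau P).

Lemma pell_addA : associative pell_add.
Proof.
by move=> P Q R; apply: val_inj; rewrite /= /coords_add /=; congr pair; ring.
Qed.

Lemma pell_addC : commutative pell_add.
Proof.
by move=> P Q; apply: val_inj; rewrite /= /coords_add /=; congr pair; ring.
Qed.

Lemma pell_add0 : left_id pell_zero pell_add.
Proof.
move=> P; apply: val_inj; rewrite /= /coords_add /= [RHS]surjective_pairing.
by congr pair; ring.
Qed.

Lemma pell_addN : left_inverse pell_zero pell_opp pell_add.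
Proof.
move=> P; apply: val_inj; rewrite /= /coords_add /=; congr pair; last by ring.
by rewrite -[RHS](pellP P) /Q0; ring.
Qed.

HB.instance Definition _ :=
  GRing.isZmodule.Build pell pell_addA pell_addC pell_add0 pell_addN.

Lemma pell_act_is_zmod_morphism (tau : absGal) : zmod_morphism (pell_act tau).
Proof.
move=> P Q; apply: val_inj.
rewrite /= /coords_act /coords_add /=.
by rewrite !(rmorphN, rmorphD, rmorphM, rmorph_int).
Qed.
HB.instance Definition _ (tau : absGal) :=
  GRing.isZmodMorphism.Build pell pell (pell_act tau)
    (pell_act_is_zmod_morphism tau).

Definition pell_gal (tau : absGal) : {additive pell -> pell} := pell_act tau.

Definition in_pell (R : {pred algC}) : {pred pell} :=
  fun P => ((coords P).1 \in R) && ((coords P).2 \in R).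

Lemma in_pell_zmod_closed (R : subringClosed algC) : zmod_closed (in_pell R).
Proof.
split=> [|P Q /andP[P1 P2] /andP[Q1 Q2]]; apply/andP; split=> /=.
- exact: rpred1.
- exact: rpred0.
- by rewrite !(rpredD, rpredN, rpredM, rpred_int).
- by rewrite !(rpredD, rpredN, rpredM, rpred_int).
Qed.

Definition pell_over (R : subringClosed algC) : zmodClosed pell :=
  subgroup_of (in_pell_zmod_closed R).

End Pell.

(* the least element of p, and 0 if p is empty *)
Definition least (p : pred nat) : nat :=
  if pselect (exists n, p n) is left h then ex_minn h else 0.

Definition den (alpha : algC) : nat :=
  least [pred n | (0 < n)%N && (n%:R * alpha \in Aint)].

Definition degQ (alpha : algC) : nat := (size (minCpoly alpha)).-1.

Definition normQ (alpha : algC) : algC :=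
  \prod_(r <- sval (closed_field_poly_normal (minCpoly alpha))) r.

Section Primitive.
Variables sigma m : int.
Implicit Type P : pell sigma m.

Definition denom P : nat := den (coords P).2.

(* A ^ d * N(y) for y of degree d: the norm of the algebraic integer A * y, so
   the floor is exact.  It is A ^ 2 * N(y) for quadratic y; with the exponent 2 in
   every degree, the rational point (3/5, 4/5) of x^2 + y^2 = 1 would not be
   primitive. *)
Definition scaled_norm P : int :=
  let: (_, y) := coords P in Num.floor ((denom P)%:R ^+ degQ y * normQ y).

Definition inv_norm P : nat :=
  least [pred a : nat | (0 < a)%N &&
    (a%:Z * scaled_norm P == 1 %[mod (denom P)%:Z ^+ 2])%Z].

Definition ratio_rep P : algC :=
  let: (x, y) := coords P in
  if y == 0 then 0 else (inv_norm P)%:R * (scaled_norm P)%:~R * x / y.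

(* [%A] congruences are modulo the multiples of A ^ 2 by algebraic integers.
   Only the class of [ratio_rep P] modulo A ^ 2 is required to be that of a
   rational integer: for the integral point (sqrt 2, i) of x^2 + y^2 = 1 the
   number itself is -i * sqrt 2. *)
Definition prim : {pred pell sigma m} := fun P =>
  `[< let A := denom P in
      [/\ A%:R * (coords P).1 \in Aint,
          coprimez (scaled_norm P) (A%:Z ^+ 2),
          coprimez A (sigma + 4 * m)
        & exists b : int, (ratio_rep P == b%:~R %[mod A%:R ^+ 2])%A] >].

Definition ratio P : nat :=
  least [pred k | (k%:R == ratio_rep P %[mod (denom P)%:R ^+ 2])%A].

Definition gamma P : algC := Q0 sigma m (ratio P)%:R 1 / (denom P)%:R ^+ 2.

Definition QP P (q : algC * algC) : algC :=
  let: (t, u) := q in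
  (denom P)%:R ^+ 2 * t ^+ 2 + (2 * (ratio P)%:R + sigma%:~R) * t * u
    + gamma P * u ^+ 2.

Definition int_sol P (q : algC * algC) : Prop :=
  [/\ q.1 \in Aint, q.2 \in Aint & QP P q = 1].

Definition nu P (q2 q1 : algC * algC) : algC * algC :=
  let: (t1, u1) := q1 in let: (t2, u2) := q2 in
  let A := (denom P)%:R in let beta := (ratio P)%:R in
  ((A ^+ 2 * t1 + (beta + sigma%:~R) * u1) * t2
     + (beta * t1 + gamma P * u1) * u2,
   - u1 * t2 + t1 * u2).

End Primitive.

Definition squarefreez (n : int) : Prop :=
  forall d : int, (d ^+ 2 %| n)%Z -> d \is a GRing.unit.

(* 1 is counted as a fundamental discriminant. *)
Definition fundamental_discriminant (D : int) : Prop :=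
  ((D == 1 %[mod 4])%Z /\ squarefreez D) \/
  (exists n : int, [/\ D = 4 * n, (n == 2 %[mod 4])%Z || (n == 3 %[mod 4])%Z
                     & squarefreez n]).

(* Main.v *)
(* With w a root of T^2 - sigma T - m, a point (x, y) is the norm-one element
   x + y w of the algebra algC[w].  It is primitive exactly when it generates, over
   the algebraic integers, a fractional ideal that comes from Z[w].  Such an ideal
   has a basis A, (b + w) / A with A^2 dividing Q_0(b, 1), which gives A and the
   ratio b; gcd(A, Delta) = 1 is automatic because Delta is fundamental.
   Primitive points are therefore closed under products and contain the rational
   and the integral ones.  The solutions (t, u) of Q_P = 1 are the coordinates of
   the generators of the ideal of P, and nu is the quotient of two generators.
   So tau P - P is integral and xi is the connecting map P |-> (tau P - P) of
   P(Zbar) -> Prim -> Prim / P(Zbar), from which exactness follows at once. *)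
Require Import Defs.
From HB Require Import structures.
From mathcomp Require Import all_boot all_order all_algebra all_field.
From mathcomp Require Import boolp ring zify.

Set Implicit Arguments.
Unset Strict Implicit.
Unset Printing Implicit Defensive.

Import Order.TTheory GRing.Theory Num.Theory.
Local Open Scope ring_scope.

(** * Galois conjugates of algebraic numbers *)

Lemma minCpoly_prod_XsubC x :
  {s : seq algC | minCpoly x = \prod_(r <- s) ('X - r%:P)}.
Proof.
have [s Ds] := closed_field_poly_normal (minCpoly x).
by exists s; rewrite {1}Ds (monicP (minCpoly_monic x)) scale1r.
Qed.

(** The coefficients of [minPoly 1 a] are rational, so its image under [LC] is a rational polynomial
    vanishing at [LC a], hence a multiple of [minCpoly (LC a)]. *)
Lemma minPoly1_root (L : fieldExtType rat) (LC : {rmorphism L -> algC}) a b :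
  root (minCpoly (LC a)) (LC b) -> root (minPoly 1 a) b.
Proof.
move=> rab; rewrite -(fmorph_root LC).
have [q1 Dp1]: exists q1, map_poly LC (minPoly 1 a) = map_poly ratr q1.
  have aP i: (minPoly 1 a)`_i \in 1%VS.
    by apply/polyOverP; apply: minPolyOver.
  have{aP} a_ i := sig_eqW (vlineP _ _ (aP i)).
  exists (\poly_(i < size (minPoly 1 a)) sval (a_ i)).
  apply/polyP=> i; rewrite coef_poly coef_map coef_poly /=.
  case: ifP => _; rewrite ?rmorph0 //; case: (a_ i) => c /= ->.
  by rewrite alg_num_field fmorph_rat.
have: root (map_poly LC (minPoly 1 a)) (LC a) by rewrite fmorph_root root_minPoly.
rewrite Dp1; have [q2 [Dq2 _] ->] := minCpolyP (LC a).
by case/dvdpP=> r1 ->; rewrite rmorphM rootM /= -Dq2 rab orbT.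
Qed.

(** Both numbers lie in the splitting field of [minCpoly x], which is normal over Q; an automorphism
    of it sending [x] to [y] extends to [algC]. *)
Lemma minCpoly_root_aut x y :
  root (minCpoly x) y -> exists nu : {rmorphism algC -> algC}, nu x = y.
Proof.
move=> rxy; have [s Ds] := minCpoly_prod_XsubC x.
have [L [LC [s1 Ds1 genL]]] := num_field_exists s.
have sx : x \in s by rewrite -root_prod_XsubC -Ds root_minCpoly.
have sy : y \in s by rewrite -root_prod_XsubC -Ds.
have [a sa Da]: exists2 a, a \in s1 & x = LC a by apply/mapP; rewrite Ds1.
have [b sb Db]: exists2 b, b \in s1 & y = LC b by apply/mapP; rewrite Ds1.
have [p [Dp _] _] := minCpolyP x.
have splitL : SplittingField.axiom L.
  exists (map_poly (in_alg L) p).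
    by apply/polyOver1P; exists p.
  exists s1 => //.
  suffices ->: map_poly (in_alg L) p = \prod_(z <- s1) ('X - z%:P).
    exact: eqpxx.
  apply: (@map_poly_inj _ _ LC). rewrite -map_poly_comp.
  have -> : map_poly (LC \o in_alg L) p = map_poly ratr p.
    by apply: eq_map_poly => c; rewrite /= alg_num_field fmorph_rat.
  rewrite -Dp Ds -Ds1 big_map rmorph_prod /=; apply: eq_bigr => z _.
  by rewrite rmorphB /= map_polyX map_polyC.
pose LM := FieldExt_isSplittingField.Build _ L splitL.
pose L' : splittingFieldType rat := HB.pack L LM.
have [||||u _ uab] := @normalField_root_minPoly _ L' 1%AS {:L'}%AS a b.
- exact: sub1v.
- exact: normalFieldf.
- exact: memvf.
- by apply: minPoly1_root (_ : root (minCpoly (LC a)) (LC b)); rewrite -Da -Db.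
have [nu Dnu] := extend_algC_subfield_aut LC (u : {rmorphism L' -> L'}).
by exists nu; rewrite Da -Dnu Db; congr (LC _); apply: uab.
Qed.

Lemma fixed_Crat x :
  (forall nu : {rmorphism algC -> algC}, nu x = x) -> x \in Crat.
Proof.
(* All the roots of the minimal polynomial equal x, so their sum is deg(x) * x. *)
move=> fix_x; have [p [Dp _] _] := minCpolyP x.
have [s Ds] := minCpoly_prod_XsubC x.
have sx z : z \in s -> z = x.
  by rewrite -root_prod_XsubC -Ds => /minCpoly_root_aut[nu <-].
have s0 : (0 < size s)%N.
  by have := size_minCpoly x; rewrite Ds size_prod_XsubC.
have := coefPn_prod_XsubC (lt0n_neq0 s0).
rewrite -Ds Dp coef_map /= (eq_big_seq (fun=> x)) //.
rewrite big_const_seq count_predT iter_addr_0 => Ex.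
have -> : x = - ratr p`_(size s).-1 / (size s)%:R.
  by rewrite Ex opprK -(mulr_natr x) mulfK // pnatr_eq0 -lt0n.
by rewrite rpred_div ?rpredN ?Crat_rat ?rpred_nat.
Qed.

(** * Congruences and norms of algebraic integers *)

Lemma leastP (p : pred nat) : (exists n, p n) -> p (least p).
Proof. by rewrite /least; case: pselect => // h _; case: ex_minnP. Qed.

Lemma least_min (p : pred nat) n : p n -> (least p <= n)%N.
Proof.
rewrite /least; case: pselect => [h pn|//]; case: ex_minnP => k _; exact.
Qed.

Lemma Aint_int_dvd (d n : int) : d != 0 ->
  (n%:~R / d%:~R \in Aint) = (d %| n)%Z.
Proof.
move=> d0; have d0C : d%:~R != 0 :> algC by rewrite intr_eq0.
apply/idP/dvdzP => [|[q ->]]; last by rewrite rmorphM mulfK ?Aint_int.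
move=> /(Cint_rat_Aint _); rewrite rpred_div ?rpred_int // => /(_ isT).
case/intrP=> q /(congr1 ( *%R^~ d%:~R)); rewrite divfK // => Eq.
by exists q; apply: (@intr_inj algC); rewrite rmorphM.
Qed.

Lemma dvdA_intE (d n : int) : ((d%:~R : algC) %| (n%:~R : algC))%A = (d %| n)%Z.
Proof.
rewrite [LHS]unfold_in; have [->|d0] := eqVneq d 0.
  by rewrite eqxx intr_eq0 dvd0z.
by rewrite intr_eq0 (negPf d0) Aint_int_dvd.
Qed.

Lemma eqAmod_intE (d n k : int) :
  ((n%:~R : algC) == (k%:~R : algC) %[mod d%:~R : algC])%A = (n == k %[mod d])%Z.
Proof. by rewrite /eqAmod -rmorphB /= dvdA_intE eqz_mod_dvd. Qed.

Lemma eqAmodE (e x y : algC) : e != 0 ->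
  (x == y %[mod e])%A = ((x - y) / e \in Aint).
Proof. by move=> e0; rewrite /eqAmod [LHS]unfold_in (negPf e0). Qed.

Lemma eqAmod_aut (nu : absGal) (e x y : algC) :
  (nu x == nu y %[mod nu e])%A = (x == y %[mod e])%A.
Proof.
have [->|e0] := eqVneq e 0.
  by rewrite rmorph0 /eqAmod -rmorphB ![in LHS]unfold_in ![in RHS]unfold_in /=
             eqxx fmorph_eq0.
by rewrite !eqAmodE ?fmorph_eq0 // -rmorphB -fmorph_div Aint_aut.
Qed.

(** The substitute for a gcd condition on the irrational number [A * y]: for rational [e] it passes
    to conjugates, and then through products to the norm. *)
Definition unitA (e u : algC) : Prop :=
  exists2 z, z \in Aint & (u * z == 1 %[mod e])%A.

Lemma unitA_prod (I : eqType) (s : seq I) (F : I -> algC) e :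
  (forall i, i \in s -> F i \in Aint /\ unitA e (F i)) ->
  unitA e (\prod_(i <- s) F i).
Proof.
elim: s => [|i s IH] us; first by rewrite big_nil; exists 1; rewrite ?mulr1.
have [Fi [z Zz Ez]] := us i (mem_head _ _).
have [|w Zw Ew] := IH => [j js|]; first by apply: us; rewrite inE js orbT.
exists (z * w); first exact: rpredM.
by rewrite big_cons mulrACA -[X in eqAmod _ _ X]mulr1 eqAmodM ?rpredM.
Qed.

(** Write [n * z - 1 = d * w]. A common divisor [g] of [n] and [d] divides 1 in the algebraic
    integers, hence in Z. *)
Lemma unitA_int (d n : int) : unitA d%:~R n%:~R -> coprimez n d.
Proof.
case=> z Zz; rewrite /eqAmod => Enz.
have [d0|d0] := eqVneq d 0.
  (* Congruence modulo 0 is equality, so here [n] itself divides 1. *)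
  move: Enz; rewrite d0 unfold_in eqxx subr_eq0 => /eqP Enz.
  have n0 : n != 0 by apply: contra_eq_neq Enz => ->; rewrite mul0r eq_sym oner_eq0.
  have: (n %| 1)%Z.
    have nC : n%:~R != 0 :> algC by rewrite intr_eq0.
    rewrite -Aint_int_dvd // mul1r (_ : _^-1 = z) //.
    by apply: (mulfI nC); rewrite divff.
  by rewrite dvdz1 /coprimez gcdz0 => /eqP->.
move: Enz; rewrite unfold_in intr_eq0 (negPf d0) => Zw.
have g0 : gcdz n d != 0 by rewrite gcdz_eq0 negb_and d0 orbT.
have [gn gd] := (dvdz_gcdl n d, dvdz_gcdr n d).
rewrite /coprimez; have := gez0_abs (isT : 0 <= gcdz n d).
move: (gcdz n d) g0 gn gd => g g0 gn gd.
have: (g %| 1)%Z.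
  rewrite -Aint_int_dvd //.
  have -> : 1%:~R / g%:~R =
      n%:~R / g%:~R * z - d%:~R / g%:~R * ((n%:~R * z - 1) / d%:~R) :> algC.
    by field; rewrite !intr_eq0 d0.
  by rewrite rpredB // rpredM // Aint_int_dvd.
by rewrite dvdz1 => /eqP-> <-.
Qed.

Lemma normQ_prod y : exists2 s : seq algC,
  (forall r, r \in s -> exists nu : absGal, r = nu y) &
  [/\ y \in s, size s = degQ y & normQ y = \prod_(r <- s) r].
Proof.
rewrite /normQ; case: closed_field_poly_normal => s /= Ds; exists s.
  move=> r rs; have [|nu <-] := @minCpoly_root_aut y r; last by exists nu.
  by rewrite Ds (monicP (minCpoly_monic y)) scale1r root_prod_XsubC.
split=> //.
  have := root_minCpoly y.
  by rewrite Ds (monicP (minCpoly_monic y)) scale1r root_prod_XsubC.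
by rewrite /degQ {1}Ds (monicP (minCpoly_monic y)) scale1r size_prod_XsubC.
Qed.

Lemma scale_normQ (k : algC) y : exists2 s : seq algC,
  (forall r, r \in s -> exists nu : absGal, r = k * nu y) &
  k * y \in s /\ k ^+ degQ y * normQ y = \prod_(r <- s) r.
Proof.
have [s sP [ys <- ->]] := normQ_prod y; exists [seq k * r | r <- s].
  by move=> _ /mapP[r /sP[nu ->] ->]; exists nu.
split; first exact: map_f.
by rewrite big_map big_split /= big_const_seq count_predT iter_mulr_1.
Qed.

Lemma normQ_Crat y : normQ y \in Crat.
Proof.
rewrite /normQ; case: closed_field_poly_normal => s /= Ds.
rewrite (monicP (minCpoly_monic y)) scale1r in Ds.
have [p [Dp _] _] := minCpolyP y.
have := coef0_prod_XsubC s; rewrite -Ds Dp coef_map /= => E.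
have -> : \prod_(r <- s) r = (-1) ^+ size s * ratr p`_0.
  by rewrite E signrMK.
by rewrite rpredM ?Crat_rat // rpredX // rpredN1.
Qed.

Section ScaledNorm.
Variables (y : algC) (k : nat).
Hypothesis Zky : k%:R * y \in Aint.
Let n := Num.floor (k%:R ^+ degQ y * normQ y).

Let Zconj (nu : absGal) : k%:R * nu y \in Aint.
Proof. by rewrite -(rmorph_nat nu k) -rmorphM Aint_aut. Qed.

Lemma scale_normQ_int : n%:~R = k%:R ^+ degQ y * normQ y :> algC.
Proof.
apply/floorK/Cint_rat_Aint.
  by rewrite rpredM ?normQ_Crat // rpredX // rpred_nat.
have [s sP [_ ->]] := scale_normQ k%:R y.
by rewrite big_seq rpred_prod // => r /sP[nu ->].
Qed.

(** The cofactor is the product of the other conjugates of [k * y]. It replaces the division by [y]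
    in [ratio_rep]. *)
Lemma scale_normQ_cofactor : exists2 C, C \in Aint & n%:~R = k%:R * y * C.
Proof.
rewrite scale_normQ_int; have [s sP [ys ->]] := scale_normQ k%:R y.
exists (\prod_(r <- rem (k%:R * y) s) r); last by rewrite (big_rem _ ys).
by rewrite big_seq rpred_prod // => r /mem_rem /sP[nu ->].
Qed.

(** As [d] is fixed by the Galois group, all conjugates of [k * y] are units modulo [d], and so is
    their product. *)
Lemma scale_normQ_coprime (d : int) :
  unitA d%:~R (k%:R * y) -> coprimez n d.
Proof.
move=> [z Zz Ez]; apply: unitA_int; rewrite scale_normQ_int.
have [s sP [_ ->]] := scale_normQ k%:R y.
apply: unitA_prod => r /sP[nu ->]; split=> //.
exists (nu z); first by rewrite Aint_aut.
by rewrite -(eqAmod_aut nu) !rmorphM rmorph_nat rmorph_int rmorph1 in Ez.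
Qed.

End ScaledNorm.

(** * Primitive points and binary forms *)

Lemma eqAmod1 (x y : algC) : x - y \in Aint -> (x == y %[mod 1 : algC])%A.
Proof. by rewrite eqAmodE ?oner_eq0 // divr1. Qed.

Lemma den_Aint (y : algC) : y \in Aint -> den y = 1%N.
Proof.
move=> Zy; have Z1y : (0 < 1)%N && (1%:R * y \in Aint) by rewrite mul1r.
have /andP[d0 _] :=
  leastP (ex_intro (fun n => is_true ([pred n | (0 < n)%N && (n%:R * y \in Aint)] n))
    1%N Z1y).
have := @least_min [pred n | (0 < n)%N && (n%:R * y \in Aint)] 1 Z1y.
by rewrite -/(den y) in d0 *; case: (den y) d0 => [|[]].
Qed.

Section Forms.
Variables sigma m : int.
Implicit Type P : pell sigma m.

(* A (x + y w) = A^2 t + (b + w) u with t, u integral. *)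
Definition form_point P (A : nat) (b : int) : Prop :=
  [/\ (0 < A)%N, Q0 sigma m b%:~R 1 / A%:R ^+ 2 \in Aint,
      A%:R * (coords P).2 \in Aint
    & ((coords P).1 - b%:~R * (coords P).2) / A%:R \in Aint].

(** The default value 0 of [den] is excluded by the coprimality clause of [prim]: with A = 0 the
    scaled norm is 0 too, the degree of y being positive, and gcd(0, 0) is not 1. *)
Lemma prim_denom P : P \in @prim sigma m ->
  (0 < denom P)%N /\ (denom P)%:R * (coords P).2 \in Aint.
Proof.
move=> /asboolP[_ cop _ _].
suff /leastP/andP[] : exists n,
  [pred n | (0 < n)%N && (n%:R * (coords P).2 \in Aint)] n by [].
case: (boolP `[< exists n, (0 < n)%N && (n%:R * (coords P).2 \in Aint) >])
  => [/asboolP//|no].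
have dP : denom P = 0%N.
  by rewrite /denom /den /least; case: pselect => // h; case/asboolP: no.
move: cop; rewrite /scaled_norm; case: P {no} dP => -[x y] /= Pxy ->.
have: (0 < degQ y)%N.
  by rewrite /degQ -ltnS prednK ?size_minCpoly // ltnW ?size_minCpoly.
by case: (degQ y) => // d _; rewrite exprS !mul0r floor0 /coprimez gcd0z.
Qed.

Lemma inv_normP P : (0 < denom P)%N ->
  coprimez (scaled_norm P) ((denom P)%:Z ^+ 2) ->
  ((inv_norm P)%:R * (scaled_norm P)%:~R == 1 %[mod (denom P)%:R ^+ 2 : algC])%A.
Proof.
set D := (denom P)%:Z ^+ 2; move=> A0 cop.
have [u [v uv1]] : exists u v : int, u * scaled_norm P + v * D = 1.
  by have /coprimezP[[u v]] := cop; exists u, v.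
have D0 : 0 < D by rewrite exprn_gt0 // ltz_nat.
have Dn0 := lt0r_neq0 D0.
have [a a_ok] : exists a : nat,
    (0 < a)%N && (a%:Z * scaled_norm P == 1 %[mod D])%Z.
  (* Adding [|D|] makes the witness positive: for [D = 1] the residue of [u] is 0. *)
  exists (`|(u %% D)%Z| + `|D|)%N; rewrite PoszD !gez0_abs ?modz_ge0 ?(ltW D0) //.
  apply/andP; split; first by rewrite addn_gt0 orbC absz_gt0 Dn0.
  rewrite eqz_mod_dvd.
  apply/dvdzP; exists (scaled_norm P * (1 - (u %/ D)%Z) - v).
  have := divz_eq u D; move: (u %/ D)%Z (u %% D)%Z => q r Eu.
  by rewrite -[X in _ - X]uv1 Eu; ring.
have /andP[_] := leastP (ex_intro _ a a_ok : exists n, [pred a : nat | (0 < a)%N &&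
    (a%:Z * scaled_norm P == 1 %[mod D])%Z] n).
by rewrite -/(inv_norm P) -eqAmod_intE /D intrM rmorphXn.
Qed.

(** The scaled norm is [A * y * C], so with [a = inv_norm P] the number [a * C] inverts [A * y]
    modulo [A ^ 2], and the congruence for [b] becomes [A * x == b * (A * y)]. Inserting this in the
    norm equation and cancelling [(A * y) ^ 2] shows that [A ^ 2] divides [Q0(b, 1)]. *)
Lemma prim_form P b : P \in @prim sigma m ->
  (ratio_rep P == b%:~R %[mod ((denom P)%:R ^+ 2 : algC)])%A ->
  form_point P (denom P) b.
Proof.
move=> Pprim Eb; have [A0 ZAy] := prim_denom Pprim.
have /asboolP[ZAx cop _ _] := Pprim.
have A0C : (denom P)%:R != 0 :> algC by rewrite pnatr_eq0 -lt0n.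
have A20 := expf_neq0 2 A0C.
have Ea := inv_normP A0 cop.
have ZQ : Q0 sigma m b%:~R 1 \in Aint.
  by rewrite /Q0 !(rpredD, rpredN, rpredM, rpredX, rpred_int, rpred1).
have := @scale_normQ_cofactor _ _ ZAy.
have -> : Num.floor ((denom P)%:R ^+ degQ (coords P).2 * normQ (coords P).2)
    = scaled_norm P.
  by rewrite /scaled_norm; case: (P) => -[].
case=> C ZC En; move: Ea Eb; rewrite /ratio_rep En; rewrite /form_point.
have := pellP P; move: (inv_norm P) => a; move: ZAx ZAy A0C A20 A0.
have [y0|y0] := eqVneq (coords P).2 0.
  have -> : denom P = 1%N by rewrite /denom y0 den_Aint.
  rewrite y0 !mul1r expr1n !divr1 => ZAx *; split=> //.
  by rewrite mulr0 subr0.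
move: (denom P) y0 => A; case: (coords P) => x y /= y0 ZAx ZAy A0C A20 A0 Q1 Ea.
rewrite (negPf y0).
have -> : a%:R * (A%:R * y * C) * x / y = a%:R * C * (A%:R * x) by field.
move=> Eb.
have EX : (A%:R * x == b%:~R * (A%:R * y) %[mod (A%:R ^+ 2 : algC)])%A.
  rewrite -[X in (X == _ %[mod _])%A]mul1r;
  apply: (eqAmod_trans (y := a%:R * (A%:R * y * C) * (A%:R * x))).
    by rewrite eqAmod_sym eqAmodMr.
  by rewrite (_ : _ * _ = a%:R * C * (A%:R * x) * (A%:R * y)) ?eqAmodMr //; ring.
split=> //; last first.
  by move: EX; rewrite eqAmodE // (_ : _ / _ = (x - b%:~R * y) / A%:R) //; field.
have EY : ((A%:R * y) ^+ 2 * Q0 sigma m b%:~R 1 == 0 %[mod (A%:R ^+ 2 : algC)])%A.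
  rewrite eqAmodE // subr0.
  move: EX; rewrite eqAmodE // => Zw.
  set w := (_ / _) in Zw.
  (* With [X = A * x] and [Y = A * y], the numbers [A ^ 2 = Q0(X, Y)] and [Y ^ 2 * Q0(b, 1)] differ
     by [(X - b Y) (X + b Y + sigma Y)]. *)
  have -> : (A%:R * y) ^+ 2 * Q0 sigma m b%:~R 1 / A%:R ^+ 2 =
     1 - w * (A%:R * x + b%:~R * (A%:R * y) + sigma%:~R * (A%:R * y)).
    rewrite -[X in X - _]Q1 /Q0 /w; field; exact: A0C.
  by rewrite rpredB ?rpred1 // rpredM // !rpredD // rpredM ?rpred_int.
rewrite -[Q0 _ _ _ _]subr0 -eqAmodE // -[X in (X == _ %[mod _])%A]mul1r.
have ZaN : a%:R * (A%:R * y * C) \in Aint by rewrite rpredM ?rpred_nat // rpredM.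
have EA2 : ((a%:R * (A%:R * y * C)) ^+ 2 == 1 %[mod (A%:R ^+ 2 : algC)])%A.
  by rewrite -[X in eqAmod _ _ X]mulr1 expr2 eqAmodM.
apply: (eqAmod_trans (y := (a%:R * (A%:R * y * C)) ^+ 2 * Q0 sigma m b%:~R 1)).
  by rewrite eqAmod_sym eqAmodMr.
rewrite (_ : _ * _ = (a%:R * C) ^+ 2 * ((A%:R * y) ^+ 2 * Q0 sigma m b%:~R 1));
  last by ring.
rewrite -[X in eqAmod _ _ X](mulr0 ((a%:R * C) ^+ 2)).
by rewrite eqAmodMl ?rpredX ?rpredM ?rpred_nat.
Qed.

Lemma ratio_form P : P \in @prim sigma m -> form_point P (denom P) (Defs.ratio P)%:Z.
Proof.
move=> Pprim; apply: prim_form => //; rewrite eqAmod_sym.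
have /asboolP[_ _ _ [b Eb]] := Pprim; have [A0 _] := prim_denom Pprim.
have D0 : 0 < (denom P)%:Z ^+ 2 by rewrite exprn_gt0 // ltz_nat.
apply: (leastP (p := [pred k |
  ((k%:R : algC) == ratio_rep P %[mod ((denom P)%:R ^+ 2 : algC)])%A])).
(* The residue of [b] modulo [A ^ 2] is a candidate, so [ratio P] is a true minimum and not the
   default of [least]. *)
exists `|(b %% ((denom P)%:Z ^+ 2))%Z|%N => /=.
rewrite eqAmod_sym; apply: eqAmod_trans Eb _.
have -> : (denom P)%:R ^+ 2 = ((denom P)%:Z ^+ 2)%:~R :> algC by rewrite rmorphXn.
rewrite pmulrn gez0_abs ?modz_ge0 ?(lt0r_neq0 D0) //.
by rewrite eqAmod_sym eqAmod_intE modz_mod.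
Qed.
End Forms.

Lemma prime_not_unitz (p : nat) : prime p -> (p%:Z \is a GRing.unit) = false.
Proof. by case: p => [|[|p]]. Qed.

(* (2 b + sigma)^2 = 4 (b^2 + sigma b - m) + Delta, so a common prime factor p of A
   and Delta has p^2 dividing Delta. *)
Lemma coprime_fundamental (sigma m b : int) (A : nat) :
  fundamental_discriminant (sigma + 4 * m) -> sigma = 0 \/ sigma = 1 ->
  (A%:Z ^+ 2 %| b ^+ 2 + sigma * b - m)%Z -> coprimez A (sigma + 4 * m).
Proof.
move=> fund hs A2f; rewrite coprimezE; apply/negPn/negP => ncop.
have g1 : (1 < gcdn A `|(sigma + 4 * m)%R|)%N.
  rewrite ltn_neqAle eq_sym ncop gcdn_gt0 /=; apply/orP; right.
  by rewrite absz_gt0; case: fund => [[]|[n []]]; case: hs => ->; lia.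
have [p p_pr] : exists2 p, prime p & (p %| gcdn A `|(sigma + 4 * m)%R|)%N.
  by exists (pdiv (gcdn A `|(sigma + 4 * m)%R|)); rewrite ?pdiv_prime ?pdiv_dvd.
rewrite dvdn_gcd => /andP[pA pD].
have {}pA : (p%:Z ^+ 2 %| A%:Z ^+ 2)%Z by rewrite dvdz_exp2r.
have {pA A2f} p2f := dvdz_trans pA A2f.
have sq : (2 * b + sigma) ^+ 2 = 4 * (b ^+ 2 + sigma * b - m) + (sigma + 4 * m).
  by case: hs => ->; ring.
have p1 : (p%:Z %| 2 * b + sigma)%Z.
  have: (p%:Z %| (2 * b + sigma) ^+ 2)%Z.
    rewrite sq rpredD //; apply: dvdz_mull; apply: dvdz_trans p2f.
    by rewrite expr2 dvdz_mulr.
  by rewrite !dvdzE abszX Euclid_dvdX // andbT.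
have p2D : (p%:Z ^+ 2 %| sigma + 4 * m)%Z.
  have -> : sigma + 4 * m = (2 * b + sigma) ^+ 2 - 4 * (b ^+ 2 + sigma * b - m).
    by rewrite sq; ring.
  by rewrite rpredB ?dvdz_exp2r // dvdz_mull.
case: fund => [[_ /(_ _ p2D)]|[n [Dn n23 sqf]]]; first by rewrite prime_not_unitz.
have [s0 mn] : sigma = 0 /\ m = n by move: hs Dn; clear; lia.
have [p_2|pn2] := eqVneq p 2%N.
  (* For [p = 2], [n] is congruent to [b ^ 2] modulo 4, hence to 0 or 1, and not to 2 or 3. *)
  move: p2f n23; rewrite p_2 s0 mn => /dvdzP[q]; rewrite mul0r addr0 => Eb.
  have [c [r [Er r01]]] : exists c r, b = 2 * c + r /\ (r = 0 \/ r = 1).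
    by exists (b %/ 2)%Z, (b %% 2)%Z; clear; lia.
  have {Eb Er} -> : n = (c ^+ 2 + c * r - q) * 4 + r ^+ 2.
    have -> : n = b ^+ 2 - q * 2%:Z ^+ 2 by rewrite -Eb; ring.
    by rewrite Er; ring.
  by rewrite !modzMDl; case: r01 => ->.
(* For odd [p], [p ^ 2] is prime to 4, so it divides the squarefree [n]. *)
suff /sqf : (p%:Z ^+ 2 %| n)%Z by rewrite prime_not_unitz.
rewrite Dn in p2D; rewrite -(Gauss_dvdzr (n := 4)) //.
rewrite coprimezE abszX (_ : `|4%:Z|%N = 2 ^ 2)%N //.
by rewrite coprimeXl // coprimeXr // prime_coprime // dvdn_prime2.
Qed.

(** * The fractional ideal of a point *)

Lemma Aint_sqr_int (r : algC) : r \in Crat -> r ^+ 2 \in Aint -> r \in Num.int.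
Proof.
move=> Qr /(Cint_rat_Aint (rpredX 2 Qr)) Zr2; apply: Cint_rat_Aint => //.
apply: (@root_monic_Aint ('X^2 - (r ^+ 2)%:P)).
- by rewrite rootE !hornerE subrr.
- by rewrite monicXnsubC.
- apply/polyOverP=> i; rewrite coefB coefXn coefC rpredB ?rpred_nat //.
  by case: ifP => _; rewrite ?rpred0.
Qed.

Lemma in_eq (T : Type) (S : {pred T}) x y : x \in S -> y = x -> y \in S.
Proof. by move=> Sx ->. Qed.

Section Ideal.
Variables sigma m : int.
Implicit Type P : pell sigma m.

(* j.1 + j.2 w lies in the fractional ideal of Z[w] below the one generated by
   P: conjugation inverts P. *)
Definition ideal_mem P (j : algC * algC) : Prop :=
  [/\ j.1 \in Crat, j.2 \in Crat,
      (coords_add sigma m (coords_opp sigma (coords P)) j).1 \in Aint &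
      (coords_add sigma m (coords_opp sigma (coords P)) j).2 \in Aint].

(* P belongs to the extension of its ideal, tested only against the ideals c Z[w]
   with c rational. *)
Definition principal P : Prop := forall c : algC, c \in Crat -> c != 0 ->
  (forall j, ideal_mem P j -> j.1 / c \in Aint /\ j.2 / c \in Aint) ->
  (coords P).1 / c \in Aint /\ (coords P).2 / c \in Aint.

Lemma ideal_memB P i j : ideal_mem P i -> ideal_mem P j ->
  ideal_mem P (i.1 - j.1, i.2 - j.2).
Proof.
case: i => w v [/= Qw Qv Z1 Z2]; case: j => w' v' [/= Qw' Qv' Z1' Z2'].
by split; rewrite /= ?rpredB //;
  [apply: (in_eq (rpredB Z1 Z1')) | apply: (in_eq (rpredB Z2 Z2'))];
  rewrite /=; ring.
Qed.

(** Multiplication by [w], with [w ^ 2 = sigma w + m]. *)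
Lemma ideal_mem_omega P j : ideal_mem P j ->
  ideal_mem P (m%:~R * j.2, j.1 + sigma%:~R * j.2).
Proof.
case: j => w v [/= Qw Qv Z1 Z2].
split=> /=; [by rewrite rpredM ?rpred_int | by rewrite rpredD ?rpredM ?rpred_int | |].
  by apply: (in_eq (rpredM (Aint_int m) Z2)); rewrite /=; ring.
by apply: (in_eq (rpredD Z1 (rpredM (Aint_int sigma) Z2))); rewrite /=; ring.
Qed.

Lemma ideal_memMn P (n : int) j : ideal_mem P j ->
  ideal_mem P (n%:~R * j.1, n%:~R * j.2).
Proof.
case: j => w v [/= Qw Qv Z1 Z2].
split=> /=; [by rewrite rpredM ?rpred_int | by rewrite rpredM ?rpred_int | |].
  by apply: (in_eq (rpredM (Aint_int n) Z1)); rewrite /=; ring.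
by apply: (in_eq (rpredM (Aint_int n) Z2)); rewrite /=; ring.
Qed.

(** [j] is the product of [P] and the integral element [P^-1 j], so a factor clearing the
    denominators of [P] clears those of [j]. *)
Lemma ideal_mem_scale P (k : algC) j : ideal_mem P j ->
  k * (coords P).1 \in Aint -> k * (coords P).2 \in Aint ->
  k * j.1 \in Aint /\ k * j.2 \in Aint.
Proof.
have := pellP P; case: (P) => -[x y] Pxy; case: j => w v.
rewrite /= => Q1 [/= _ _ Za Zc] Zx Zy.
set a := (X in X \in _) in Za; set c := (X in X \in _) in Zc.
have Ew : w = x * a + m%:~R * y * c.
  by rewrite -[LHS]mul1r -[X in X * _ = _]Q1 /a /c /Q0; ring.
have Ev : v = x * c + a * y + sigma%:~R * y * c.
  by rewrite -[LHS]mul1r -[X in X * _ = _]Q1 /a /c /Q0; ring.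
split.
  apply: (in_eq (rpredD (rpredM Zx Za) (rpredM (rpredM (Aint_int m) Zy) Zc))).
  by rewrite /= Ew; ring.
apply: (in_eq (rpredD (rpredD (rpredM Zx Zc) (rpredM Za Zy))
  (rpredM (rpredM (Aint_int sigma) Zy) Zc))).
by rewrite /= Ev; ring.
Qed.

Lemma ideal_mem_const P (r : algC) : r \in Crat ->
  r * (coords P).1 \in Aint -> r * (coords P).2 \in Aint -> ideal_mem P (r, 0).
Proof.
move=> Qr Zx Zy; split=> /=; [exact: Qr | exact: rpred0 | |].
  apply: (in_eq (rpredD Zx (rpredM (Aint_int sigma) Zy))); rewrite /=; ring.
by rewrite -rpredN; apply: (in_eq Zy); rewrite /=; ring.
Qed.

(* The ideal meets Q in A Z, A the least common denominator of x and y.  The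
   w-coordinates of A times the ideal form an ideal g Z of Z, so that P is divisible
   by g / A, and minimality of A forces g = 1. *)
Lemma principal_form P : principal P ->
  (exists2 A : nat, (0 < A)%N &
    A%:R * (coords P).1 \in Aint /\ A%:R * (coords P).2 \in Aint) ->
  exists A b, form_point P A b.
Proof.
move=> princ [A1 A1_gt0 [ZA1x ZA1y]].
pose intpl n := (0 < n)%N && (n%:R * (coords P).1 \in Aint) &&
  (n%:R * (coords P).2 \in Aint).
have: exists n, intpl n by exists A1; rewrite /intpl A1_gt0 ZA1x ZA1y.
case/ex_minnP => A /andP[/andP[A0 ZAx] ZAy] minA.
have A0C : A%:R != 0 :> algC by rewrite pnatr_eq0 -lt0n.
have JA : ideal_mem P (A%:R, 0) by apply: ideal_mem_const; rewrite ?rpred_nat.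
have JZ j : ideal_mem P j -> exists n : int, A%:R * j.2 = n%:~R.
  move=> Jj; have [_ Zv] := ideal_mem_scale Jj ZAx ZAy.
  case: Jj => _ Qv _ _; apply/intrP/Cint_rat_Aint => //.
  by rewrite rpredM ?rpred_nat.
pose S (n : nat) := `[< (0 < n)%N /\ exists2 j, ideal_mem P j & A%:R * j.2 = n%:R >].
have: exists n, S n.
  (* The element [A w] of the ideal has w-coordinate [A]. *)
  exists (A ^ 2)%N; apply/asboolP; split; first by rewrite expn_gt0 A0.
  eexists; first exact: ideal_mem_omega JA.
  by rewrite /= mulr0 addr0 natrX expr2.
case/ex_minnP => g /asboolP[g0 [jg Jg Eg]] ming.
have g0C : g%:R != 0 :> algC by rewrite pnatr_eq0 -lt0n.
have gdvd j : ideal_mem P j -> A%:R * j.2 / g%:R \in Aint.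
  move=> Jj; have [n En] := JZ j Jj.
  rewrite En -[g%:R]/((g%:Z)%:~R) Aint_int_dvd ?gt_eqF //.
  have Jr := ideal_memB Jj (ideal_memMn (n %/ g)%Z Jg).
  have Er : A%:R * (j.2 - (n %/ g)%Z%:~R * jg.2) = (n %% g)%Z%:~R.
    rewrite /modz rmorphB rmorphM /= -En mulrBr; congr (_ - _).
    by rewrite mulrCA Eg.
  apply/dvdz_mod0P/eqP/negPn/negP => rn0.
  have r_ge0 : 0 <= (n %% g)%Z by rewrite modz_ge0 // gt_eqF.
  have /ming : S `|(n %% g)%Z|%N.
    apply/asboolP; rewrite absz_gt0; split=> //; eexists; first exact: Jr.
    by rewrite /= Er pmulrn gez0_abs.
  by have := ltz_pmod n (g0 : 0 < g%:Z); lia.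
have [|||Zx Zy] := princ (g%:R / A%:R).
- by rewrite rpred_div ?rpred_nat.
- by rewrite mulf_neq0 ?invr_eq0.
(* The w-coordinate of [w * j] is [j.1 + sigma * j.2], so divisibility of all w-coordinates yields
   that of [j.1]. *)
- move=> j Jj; have Zv := gdvd _ Jj; have := gdvd _ (ideal_mem_omega Jj).
  rewrite /= mulrDr mulrDl => Zw; split.
    apply: (in_eq (rpredB Zw (rpredM (Aint_int sigma) Zv))); rewrite /=; field.
    by rewrite ?g0C ?A0C.
  by apply: (in_eq Zv); rewrite /=; field; rewrite ?g0C ?A0C.
pose r : algC := A%:R / g%:R.
have Qr : r \in Crat by rewrite rpred_div ?rpred_nat.
have Zrx : r * (coords P).1 \in Aint.
  by apply: (in_eq Zx); rewrite /= /r; field; rewrite ?g0C ?A0C.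
have Zry : r * (coords P).2 \in Aint.
  by apply: (in_eq Zy); rewrite /= /r; field; rewrite ?g0C ?A0C.
(* [r ^ 2] is the value of [Q0] at the integral pair [r * P]. Thus [r = A / g] is an integer
   clearing the denominators of [P], and minimality of [A] applies to it. *)
have Zr : r \in Num.int.
  apply: Aint_sqr_int => //.
  have -> : r ^+ 2 = (r * (coords P).1) ^+ 2 +
     sigma%:~R * (r * (coords P).1) * (r * (coords P).2)
     - m%:~R * (r * (coords P).2) ^+ 2.
    by rewrite -[LHS]mulr1 -[X in _ * X = _](pellP P) /Q0; ring.
  move: Zrx Zry; move: (r * _) (r * _) => X Y ZX ZY.
  by rewrite !(rpredD, rpredN, rpredM, rpredX, Aint_int).
have g1 : g = 1%N.
  have [k Ek] : exists k : nat, r = k%:R.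
    by apply/natrP; rewrite natrEint Zr divr_ge0 ?ler0n.
  have Ekg : A = (k * g)%N.
    by apply/eqP; rewrite -eqC_nat natrM -Ek divfK.
  have : (A <= k)%N.
    by apply: minA; rewrite /intpl -Ek Zrx Zry !andbT; case: (k) Ekg A0 => // ->.
  have := A0; rewrite Ekg; nia.
(* With [g = 1], [jg] is [(b + w) / A]; its quotient by [P] is integral and has norm
   [Q0(b, 1) / A ^ 2]. *)
exists A; have [Zb Z1] := ideal_mem_scale Jg ZAx ZAy.
have /intrP[b Eb] : A%:R * jg.1 \in Num.int.
  by apply: Cint_rat_Aint => //; rewrite rpredM ?rpred_nat //; case: Jg.
rewrite g1 mulr1n in Eg; exists b; case: Jg => _ _ Za Zc; split=> //.
  have -> : Q0 sigma m b%:~R 1 / A%:R ^+ 2 =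
    Q0 sigma m (coords_add sigma m (coords_opp sigma (coords P)) jg).1
       (coords_add sigma m (coords_opp sigma (coords P)) jg).2.
    rewrite Q0_add Q0_opp pellP mul1r -Eb -[X in Q0 _ _ _ X / _]Eg /Q0.
    by field; exact: A0C.
  move: Za Zc; rewrite /Q0; move: (_.1) (_.2) => a c Za Zc.
  by rewrite !(rpredD, rpredN, rpredM, rpredX, Aint_int).
have Ev : jg.2 = A%:R^-1 by apply: (mulfI A0C); rewrite Eg divff.
by apply: (in_eq Zc); rewrite /= -Eb Ev; field; exact: A0C.
Qed.

End Ideal.

(** * The group of primitive points *)

Section PrimitiveGroup.
Variables sigma m : int.
Implicit Type P : pell sigma m.

Lemma form_pointE P A b : form_point P A b ->
  exists t u, [/\ t \in Aint, u \in Aint,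
    coords P = (A%:R * t + b%:~R * u / A%:R, u / A%:R),
    A%:R ^+ 2 * t ^+ 2 + (2 * b%:~R + sigma%:~R) * t * u
      + Q0 sigma m b%:~R 1 / A%:R ^+ 2 * u ^+ 2 = 1
    & A%:R * (coords P).1 = A%:R ^+ 2 * t + b%:~R * u].
Proof.
case=> A0 ZQ Zu Zt; have A0C : A%:R != 0 :> algC by rewrite pnatr_eq0 -lt0n.
exists (((coords P).1 - b%:~R * (coords P).2) / A%:R), (A%:R * (coords P).2).
have := pellP P; case: (coords P) Zu Zt => x y /= Zu Zt Q1; split=> //.
- by congr pair; field.
- by rewrite -[RHS]Q1 /Q0; field.
- by field.
Qed.

(** With [u = A * y], the equation of [form_pointE] writes [1 - A ^ 2 * t ^ 2] as a multiple of
    [u]. *)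
Lemma form_point_unit P A b : form_point P A b ->
  unitA (A%:R ^+ 2) (A%:R * (coords P).2).
Proof.
move=> fP; have [A0 ZQ _ _] := fP; have [t [u [Zt Zu -> Q1 _]]] := form_pointE fP.
have A0C : A%:R != 0 :> algC by rewrite pnatr_eq0 -lt0n.
exists ((2 * b%:~R + sigma%:~R) * t + Q0 sigma m b%:~R 1 / A%:R ^+ 2 * u).
  by rewrite rpredD // rpredM // rpredD ?rpredM ?rpred_int ?rpred_nat.
rewrite eqAmodE ?expf_neq0 // -[X in _ - X]Q1 /=.
apply: (@in_eq _ _ (- t ^+ 2)); first by rewrite rpredN rpredX.
by field.
Qed.

(** The gcd of [A] and the denominator also clears [y]. Its cofactor [e] in [A] then divides both
    [A * y] and [A ^ 2]; since [A * y] is a unit modulo [A ^ 2], [e] divides 1. *)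
Lemma form_point_denom P A b : form_point P A b -> denom P = A.
Proof.
move=> fP; have [A0 _ Zu _] := fP; have [z Zz Euz] := form_point_unit fP.
pose p := [pred n | (0 < n)%N && (n%:R * (coords P).2 \in Aint)].
have pA : p A by rewrite /p /= A0.
have /andP[D0 ZD] : p (denom P) by apply: leastP; exists A.
apply/eqP; rewrite eqn_leq (least_min pA) dvdn_leq //.
move: (denom P) D0 ZD Euz Zu => D D0 ZD Euz Zu.
have Zg : (gcdn A D)%:R * (coords P).2 \in Aint.
  have [k l Ekl _] := egcdnP D A0.
  apply: (@in_eq _ _ (k%:R * (A%:R * (coords P).2) - l%:R * (D%:R * (coords P).2))).
    by rewrite rpredB // rpredM ?rpred_nat.
  by rewrite !mulrA -!natrM Ekl natrD; ring.
have /dvdnP[e Ae] := dvdn_gcdl A D.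
suff e1 : e = 1%N by rewrite Ae e1 mul1n dvdn_gcdr.
have e0 : (0 < e)%N by move: A0; rewrite Ae muln_gt0 => /andP[].
have e0C : e%:R != 0 :> algC by rewrite pnatr_eq0 -lt0n.
have A0C : A%:R != 0 :> algC by rewrite pnatr_eq0 -lt0n.
suff : (e%:Z %| 1)%Z by rewrite dvdz1 => /eqP.
rewrite -Aint_int_dvd ?gt_eqF //.
move: Euz; rewrite eqAmodE ?expf_neq0 // => Zw; set w := (_ / _) in Zw.
apply: (@in_eq _ _ ((gcdn A D)%:R * (coords P).2 * z - (gcdn A D)%:R * A%:R * w)).
  by rewrite rpredB // rpredM // rpredM // rpred_nat.
have EA : A%:R = e%:R * (gcdn A D)%:R :> algC by rewrite {1}Ae natrM.
rewrite mul1r; apply: (mulfI e0C); rewrite [LHS]divff // mulrBr !mulrA -EA /w.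
by field; exact: A0C.
Qed.

(** Converse of [prim_form]: the unit [A * y] gives the coprimality of the norm, and
    [A * x == b * (A * y)] modulo [A ^ 2] turns [ratio_rep P] into [b]. *)
Lemma form_prim P A b :
  fundamental_discriminant (sigma + 4 * m) -> sigma = 0 \/ sigma = 1 ->
  form_point P A b -> P \in @prim sigma m.
Proof.
move=> fund hs fP; have dP := form_point_denom fP.
have [A0 ZQ ZAy Zt] := fP; have A0C : A%:R != 0 :> algC by rewrite pnatr_eq0 -lt0n.
have [t [u [Zt' Zu' _ _ EAx]]] := form_pointE fP.
have ZAx : A%:R * (coords P).1 \in Aint.
  by rewrite EAx rpredD // rpredM ?rpredX ?rpred_nat ?rpred_int.
have nP :
    scaled_norm P = Num.floor ((denom P)%:R ^+ degQ (coords P).2 * normQ (coords P).2).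
  by rewrite /scaled_norm; case: (P) => -[].
have cop : coprimez (scaled_norm P) ((denom P)%:Z ^+ 2).
  rewrite nP dP; apply: scale_normQ_coprime => //.
  by rewrite rmorphXn; exact: form_point_unit fP.
apply/asboolP; split=> //; rewrite ?dP //.
  apply: (coprime_fundamental fund hs (b := b)).
  rewrite -Aint_int_dvd ?expf_neq0 ?gt_eqF //; apply: (in_eq ZQ).
  by rewrite /Q0 !(rmorphB, rmorphD, rmorphM, rmorphXn) /=; congr (_ / _); ring.
exists b; have dP0 : (0 < denom P)%N by rewrite dP.
have := inv_normP dP0 cop; rewrite /ratio_rep.
have [C ZC] := @scale_normQ_cofactor _ _ ZAy; rewrite -{1}dP -nP => ->; rewrite dP.
have A1 : (coords P).2 = 0 -> A = 1%N by rewrite -dP /denom => ->; apply: den_Aint.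
case: (coords P) A1 {nP} ZAx ZAy Zt => x y /= A1 ZAx ZAy Zt.
have [y0|y0] := eqVneq y 0.
  (* For [y = 0] the denominator is 1, and all integers are congruent modulo 1. *)
  by move=> _; rewrite A1 // expr1n; apply: eqAmod1; rewrite sub0r rpredN Aint_int.
have -> : (inv_norm P)%:R * (A%:R * y * C) * x / y = (inv_norm P)%:R * C * (A%:R * x).
  by field.
move: (inv_norm P) => a Ea.
have EX : (A%:R * x == b%:~R * (A%:R * y) %[mod (A%:R ^+ 2 : algC)])%A.
  by rewrite eqAmodE ?expf_neq0 //; apply: (in_eq Zt); field.
apply: (eqAmod_trans (y := a%:R * C * (b%:~R * (A%:R * y)))).
  by rewrite eqAmodMl // rpredM ?rpred_nat.
have -> : a%:R * C * (b%:~R * (A%:R * y)) = b%:~R * (a%:R * (A%:R * y * C)) by ring.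
by rewrite -[X in eqAmod _ _ X]mulr1 eqAmodMl ?Aint_int.
Qed.

(** Negation of points is conjugation, and the conjugate [b + sigma - w] of [b + w] is the opposite
    of [(- b - sigma) + w]. *)
Lemma form_point_opp P A b : form_point P A b ->
  form_point (- P) A (- b - sigma).
Proof.
move=> fP; have [A0 ZQ Zu Zt] := fP; split=> //=.
- by apply: (in_eq ZQ); rewrite /Q0; congr (_ / _); rewrite !raddfB !raddfN /=; ring.
- by rewrite mulrN rpredN.
- by apply: (in_eq Zt); congr (_ / _); rewrite !raddfB !raddfN /=; ring.
Qed.

Lemma form_ideal_mem P A b : form_point P A b ->
  ideal_mem P (A%:R, 0) /\ ideal_mem P (b%:~R / A%:R, A%:R^-1).
Proof.
move=> fP; have [A0 ZQ ZAy Zt] := fP.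
have A0C : A%:R != 0 :> algC by rewrite pnatr_eq0 -lt0n.
have [t [u [Zt' Zu' Exy _ EAx]]] := form_pointE fP; split.
  apply: ideal_mem_const; rewrite ?rpred_nat // EAx.
  by rewrite rpredD // rpredM ?rpredX ?rpred_nat ?rpred_int.
split; rewrite /= ?rpred_div ?rpredV ?rpred_nat ?rpred_int // Exy /=.
  apply: (@in_eq _ _ (b%:~R * t + Q0 sigma m b%:~R 1 / A%:R ^+ 2 * u)).
    by rewrite rpredD // rpredM // rpred_int.
  by rewrite /Q0; field.
by apply: (in_eq Zt'); field.
Qed.

(** Addition of points is multiplication of the elements [x + y w], and [(P Q)^-1 i j] is the
    product of the integral elements [P^-1 i] and [Q^-1 j]. *)
Lemma ideal_memD P Q i j : ideal_mem P i -> ideal_mem Q j ->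
  ideal_mem (P + Q) (coords_add sigma m i j).
Proof.
case=> Qi1 Qi2 Z1 Z2 [Qj1 Qj2 Z1' Z2']; split=> /=.
- by rewrite !(rpredD, rpredM, rpred_int).
- by rewrite !(rpredD, rpredM, rpred_int).
- apply: (@in_eq _ _ (coords_add sigma m
   (coords_add sigma m (coords_opp sigma (coords P)) i)
   (coords_add sigma m (coords_opp sigma (coords Q)) j)).1).
    rewrite [in X in X \in _]/coords_add; cbn [fst].
    by rewrite rpredD // !rpredM // rpred_int.
  by rewrite /=; ring.
- apply: (@in_eq _ _ (coords_add sigma m
   (coords_add sigma m (coords_opp sigma (coords P)) i)
   (coords_add sigma m (coords_opp sigma (coords Q)) j)).2).
    rewrite [in X in X \in _]/coords_add; cbn [snd].
    by rewrite !rpredD // !rpredM // rpred_int.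
  by rewrite /=; ring.
Qed.

(** The product of [P] and [Q] is an integral combination of the four products of basis elements,
    and these lie in the ideal of [P + Q]. *)
Lemma principal_add P Q A B b c : form_point P A b -> form_point Q B c ->
  principal (P + Q).
Proof.
move=> fP fQ k Qk k0 Jk.
have [P1 P2] := form_ideal_mem fP; have [Q1 Q2] := form_ideal_mem fQ.
have [A0 _ _ _] := fP; have A0C : A%:R != 0 :> algC by rewrite pnatr_eq0 -lt0n.
have [B0 _ _ _] := fQ; have B0C : B%:R != 0 :> algC by rewrite pnatr_eq0 -lt0n.
have [t [u [Zt Zu Exy _ _]]] := form_pointE fP.
have [t' [u' [Zt' Zu' Exy' _ _]]] := form_pointE fQ.
have [Z1 Y1] := Jk _ (ideal_memD P1 Q1).
have [Z2 Y2] := Jk _ (ideal_memD P1 Q2).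
have [Z3 Y3] := Jk _ (ideal_memD P2 Q1).
have [Z4 Y4] := Jk _ (ideal_memD P2 Q2).
have comb (a1 a2 a3 a4 : algC) : a1 \in Aint -> a2 \in Aint -> a3 \in Aint ->
    a4 \in Aint -> t * t' * a1 + t * u' * a2 + u * t' * a3 + u * u' * a4 \in Aint.
  by move=> *; rewrite !(rpredD, rpredM).
split.
  apply: (in_eq (comb _ _ _ _ Z1 Z2 Z3 Z4)).
  by rewrite /= Exy Exy' /=; field; rewrite A0C B0C k0.
apply: (in_eq (comb _ _ _ _ Y1 Y2 Y3 Y4)).
by rewrite /= Exy Exy' /=; field; rewrite A0C B0C k0.
Qed.

Lemma form_point_add P Q A B b c : form_point P A b -> form_point Q B c ->
  exists D d, form_point (P + Q) D d.
Proof.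
move=> fP fQ; apply: principal_form; first exact: principal_add fP fQ.
exists (A * B)%N; first by rewrite muln_gt0; case: fP fQ => -> _ _ _ [-> _ _ _].
have [[_ _ ZAy _] [_ _ ZBy _]] := (fP, fQ).
have ZAx : A%:R * (coords P).1 \in Aint.
  have [t [u [Zt Zu _ _ ->]]] := form_pointE fP.
  by rewrite rpredD // rpredM ?rpredX ?rpred_nat ?rpred_int.
have ZBx : B%:R * (coords Q).1 \in Aint.
  have [t [u [Zt Zu _ _ ->]]] := form_pointE fQ.
  by rewrite rpredD // rpredM ?rpredX ?rpred_nat ?rpred_int.
rewrite natrM /=; split.
  apply: (in_eq (rpredD (rpredM ZAx ZBx) (rpredM (rpredM (Aint_int m) ZAy) ZBy))).
  by rewrite /=; ring.
apply: (in_eq (rpredD (rpredD (rpredM ZAx ZBy) (rpredM ZBx ZAy))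
   (rpredM (rpredM (Aint_int sigma) ZAy) ZBy))).
by rewrite /=; ring.
Qed.

Lemma rational_form_point P : (coords P).1 \in Crat -> (coords P).2 \in Crat ->
  exists A b, form_point P A b.
Proof.
move=> Qx Qy; apply: principal_form.
  (* A rational [P] lies in its own ideal, with quotient 1, so the hypothesis is used at [j = P]. *)
  move=> c Qc c0; apply; split=> //=; have := pellP P; case: (coords P) => x y /=.
    by move=> Q1; apply: (in_eq Aint1); rewrite -[RHS]Q1 /Q0; ring.
  by move=> _; apply: (in_eq Aint0); ring.
case/CratP: Qx => a ->; case/CratP: Qy => b ->.
exists (`|denq a| * `|denq b|)%N; first by rewrite muln_gt0 !absz_gt0 !denq_neq0.
have EA q : (`|denq q|)%:R * ratr q = (numq q)%:~R :> algC.
  by rewrite pmulrn gez0_abs ?denq_ge0 // /ratr mulrCA divff ?mulr1 //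
             intr_eq0 denq_neq0.
rewrite natrM; split; first by rewrite mulrAC EA rpredM ?Aint_int ?rpred_nat.
by rewrite -mulrA EA rpredM ?Aint_int ?rpred_nat.
Qed.

Lemma integral_form_point P : (coords P).1 \in Aint -> (coords P).2 \in Aint ->
  form_point P 1 0.
Proof.
move=> Zx Zy; split; rewrite ?mul0r ?subr0 ?mul1r ?divr1 //.
by rewrite expr1n divr1 /Q0 !(rpredD, rpredN, rpredM, rpredX, Aint_int, Aint1).
Qed.

End PrimitiveGroup.

(** * The connecting map *)

Lemma class_of_eq0 (M : zmodType) (act : absGal -> {additive M -> M})
    (S : zmodClosed M) (f : Z1 act S) : class_of f = 0 <->
  exists2 a, a \in S & forall tau, val f tau = act tau a - a.
Proof.
rewrite -(raddf0 (@class_of _ act S)).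
split=> [/eqP|fB]; last apply/eqP; rewrite -Quotient.idealrBE subr0.
  by move/asboolP.
exact/asboolP.
Qed.

Section Cocycle.
Variables sigma m : int.
Implicit Type P : pell sigma m.
Let PZ := pell_over sigma m Aint.
Let act := @pell_gal sigma m.

Lemma prim_zmod_closed : fundamental_discriminant (sigma + 4 * m) ->
  sigma = 0 \/ sigma = 1 -> zmod_closed (@prim sigma m).
Proof.
move=> fund hs; split=> [|P Q /ratio_form fP /ratio_form/form_point_opp fQ].
  by apply: form_prim fund hs (integral_form_point _ _).
by have [D [d fPQ]] := form_point_add fP fQ; apply: form_prim fund hs fPQ.
Qed.

Lemma pell_galM (tau rho : absGal) P : act (tau \o rho) P = act tau (act rho P).
Proof. exact: val_inj. Qed.

(** The element [A t + u (b + w) / A], where [b] is the ratio of [P]. *)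
Definition form_coords P (q : algC * algC) : algC * algC :=
  (((denom P)%:R ^+ 2 * q.1 + (Defs.ratio P)%:R * q.2) / (denom P)%:R,
   q.2 / (denom P)%:R).

Lemma form_coords_pell P q : P \in @prim sigma m -> QP P q = 1 ->
  exists S : pell sigma m, coords S = form_coords P q.
Proof.
move=> /ratio_form[A0 _ _ _]; case: q => t u Q1.
have A0C : (denom P)%:R != 0 :> algC by rewrite pnatr_eq0 -lt0n.
suff QS : Q0 sigma m (form_coords P (t, u)).1 (form_coords P (t, u)).2 == 1.
  by exists (Pell QS).
by apply/eqP; rewrite -[RHS]Q1 /QP /gamma /Q0 /=; field.
Qed.

Lemma canonical_sol P : P \in @prim sigma m ->
  exists2 q, int_sol P q & form_coords P q = coords P.
Proof.
move=> /ratio_form[A0 ZQ Zu Zt].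
have A0C : (denom P)%:R != 0 :> algC by rewrite pnatr_eq0 -lt0n.
exists (((coords P).1 - (Defs.ratio P)%:R * (coords P).2) / (denom P)%:R,
        (denom P)%:R * (coords P).2); last first.
  by rewrite [RHS]surjective_pairing /form_coords /=; congr pair; field.
by split=> //=; rewrite -[RHS](pellP P) /gamma /Q0; field.
Qed.

Lemma form_coords_sub P q1 q2 (S1 S2 : pell sigma m) : P \in @prim sigma m ->
  coords S1 = form_coords P q1 -> coords S2 = form_coords P q2 ->
  coords (S2 - S1) = nu P q2 q1.
Proof.
move=> /ratio_form[A0 _ _ _].
have A0C : (denom P)%:R != 0 :> algC by rewrite pnatr_eq0 -lt0n.
case: q1 => t1 u1; case: q2 => t2 u2 E1 E2.
rewrite -[LHS]/(coords_add sigma m (coords S2) (coords_opp sigma (coords S1))).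
rewrite E1 E2 /coords_add /coords_opp /nu /gamma /Q0 /=.
by congr pair; field.
Qed.

Lemma form_coords_act P q tau :
  form_coords P (coords_act tau q) = coords_act tau (form_coords P q).
Proof.
rewrite /form_coords /coords_act /=.
by rewrite !(fmorph_div, rmorphD, rmorphM, rmorphXn, rmorph_nat).
Qed.

Lemma int_sol_act P q tau : int_sol P q ->
  (coords_act tau q).1 \in Aint /\ (coords_act tau q).2 \in Aint.
Proof. by case=> Zt Zu _; rewrite /= !Aint_aut. Qed.

Lemma form_coords_sub_integral P (q1 q2 : algC * algC) (S1 S2 : pell sigma m) :
  P \in @prim sigma m ->
  q1.1 \in Aint /\ q1.2 \in Aint -> q2.1 \in Aint /\ q2.2 \in Aint ->
  coords S1 = form_coords P q1 -> coords S2 = form_coords P q2 ->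
  S2 - S1 \in PZ.
Proof.
move=> Pprim; have [_ ZQ _ _] := ratio_form Pprim.
case: q1 q2 => t1 u1 [t2 u2] /= [Zt1 Zu1] [Zt2 Zu2] E1 E2.
have ZA2 : (denom P)%:R ^+ 2 \in Aint by rewrite rpredX ?rpred_nat.
rewrite -[_ \in PZ]/(((coords (S2 - S1)).1 \in Aint) &&
  ((coords (S2 - S1)).2 \in Aint)).
have Zg : gamma P \in Aint := ZQ.
rewrite (form_coords_sub Pprim E1 E2) /nu /=; move: (gamma P) Zg => g Zg.
by rewrite !(rpredD, rpredN, rpredM, rpred_nat, Aint_int).
Qed.

Lemma cocycle_diff (S : pell sigma m) :
  (forall tau, act tau S - S \in PZ) ->
  (fun tau => act tau S - S) \in subgroup_of (is_cocycle_zmod_closed act PZ).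
Proof.
move=> SZ; apply/asboolP; split=> // tau rho.
by rewrite pell_galM raddfB addrA subrK.
Qed.

(** The basis of the ideal and the form [Q_P] are fixed by the Galois group, so [tau P] comes from
    another integral solution, and [nu] of two integral solutions is integral. *)
Lemma prim_act_sub P tau : P \in @prim sigma m -> act tau P - P \in PZ.
Proof.
move=> Pprim; have [q solq Eq] := canonical_sol Pprim.
have [Zt Zu _] := solq.
apply: (form_coords_sub_integral Pprim (conj Zt Zu) (int_sol_act tau solq)) => //.
by rewrite form_coords_act Eq.
Qed.

End Cocycle.

Section Connecting.
Variables (sigma m : int) (hprim : zmod_closed (@prim sigma m)).
Let PZ := pell_over sigma m Aint.
Let act := @pell_gal sigma m.
Let Prim := subgroup_of hprim.

Definition gal_diff (P : subgroup Prim) : Z1 act PZ :=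
  Subgroup (cocycle_diff (fun tau => prim_act_sub tau (valP P))).

Definition connecting (P : subgroup Prim) : H1 act PZ := class_of (gal_diff P).

Lemma connecting_is_zmod_morphism : zmod_morphism connecting.
Proof.
move=> P Q; rewrite /connecting -raddfB; congr class_of; apply: val_inj.
apply/funext => tau.
rewrite -[LHS]/(act tau (val P - val Q) - (val P - val Q)).
rewrite -[RHS]/((act tau (val P) - val P) - (act tau (val Q) - val Q)).
by rewrite raddfB !opprD addrACA.
Qed.
HB.instance Definition _ := GRing.isZmodMorphism.Build (subgroup Prim) (H1 act PZ)
  connecting connecting_is_zmod_morphism.

(** Independence of [q]: the point [S] that [q] defines differs from [P] by an integral point, so
    the cocycles of [S] and [P] differ by a coboundary. *)
Lemma connecting_sol (P : subgroup Prim) q : int_sol (val P) q ->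
  exists2 f : Z1 act PZ,
    forall tau : absGal, coords (val f tau) = nu (val P) (coords_act tau q) q
    & connecting P = class_of f.
Proof.
move=> solq; have Pprim : val P \in @prim sigma m := valP P.
have [Zt Zu Q1] := solq; have Zq := conj Zt Zu.
have [S ES] := form_coords_pell Pprim Q1.
have EtS tau : coords (act tau S) = form_coords (val P) (coords_act tau q).
  by rewrite form_coords_act -ES.
have SZ tau : act tau S - S \in PZ.
  exact: form_coords_sub_integral Pprim Zq (int_sol_act tau solq) ES (EtS tau).
exists (Subgroup (cocycle_diff SZ)) => [tau|].
  exact: form_coords_sub Pprim ES (EtS tau).
apply/eqP; rewrite -Quotient.idealrBE; apply/asboolP.
have [q0 [Zt0 Zu0 _] Eq0] := canonical_sol Pprim.
exists (val P - S) => [|tau].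
  exact: form_coords_sub_integral Pprim Zq (conj Zt0 Zu0) ES (esym Eq0).
rewrite -[LHS]/((act tau (val P) - val P) - (act tau S - S)).
by rewrite (raddfB (act tau)) !opprD !opprK addrACA.
Qed.

Lemma gal_fixed_rational (P : pell sigma m) :
  (forall tau, act tau P = P) <-> P \in pell_over sigma m Crat.
Proof.
split=> [fixP|/andP[Qx Qy] tau].
  by apply/andP; split; apply: fixed_Crat => nu;
    have /(congr1 (fun Q => coords Q)) := fixP nu; case: (P) => -[x y] ? [].
by apply: val_inj; rewrite /= /coords_act !aut_Crat //; case: coords.
Qed.

End Connecting.

Theorem theorem5p5 (Delta sigma m : int)
  (hDelta : fundamental_discriminant Delta)
  (hsigma : sigma = 0 \/ sigma = 1)
  (hDelta_eq : Delta = sigma + 4 * m) :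
  let PQ := pell_over sigma m Crat in
  let PZ := pell_over sigma m Aint in
  let act := @pell_gal sigma m in
  exists hprim : zmod_closed (@prim sigma m),
  let Prim := subgroup_of hprim in
  exists (hsum : {subset sumgroup PQ PZ <= Prim})
         (hPZ : {subset PZ <= Prim})
         (xi : {additive subgroup Prim -> H1 act PZ}),
  [/\ forall P : subgroup Prim, exists q, int_sol (val P) q,
      forall (P : subgroup Prim) (q : algC * algC), int_sol (val P) q ->
        exists2 f : Z1 act PZ,
          forall tau : absGal, coords (val f tau) = nu (val P) (coords_act tau q) q
          & xi P = class_of f,
      injective (incl hsum),
      exact_at (incl hsum) xi
    & exact_at xi (@H1_incl _ act PZ Prim hPZ)].
Proof.
move=> PQ PZ act; rewrite hDelta_eq in hDelta.
have hprim := prim_zmod_closed hDelta hsigma.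
exists hprim => Prim.
have hPZ : {subset PZ <= Prim}.
  move=> P /andP[Zx Zy].
  by apply: form_prim hDelta hsigma (integral_form_point Zx Zy).
have hsum : {subset sumgroup PQ PZ <= Prim}.
  move=> _ /asboolP[P [Q [/andP[Px Py] /hPZ Qprim ->]]]; apply: rpredD => //.
  have [A [b fP]] := rational_form_point Px Py.
  exact: form_prim hDelta hsigma fP.
exists hsum, hPZ.
exists (@connecting sigma m hprim : {additive subgroup Prim -> H1 act PZ}).
split.
- move=> P; have [q ? _] := canonical_sol (valP P : val P \in @prim sigma m).
  by exists q.
- exact: connecting_sol.
- by move=> P Q /(congr1 val) /= PQ_eq; apply: val_inj.
- move=> P; have cE := class_of_eq0 (gal_diff P); split=> [/cE[a aZ Ea]|].
    (* [tau P - P = tau a - a] says that [P - a] is fixed by [tau]. *)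
    have QPa : val P - a \in PQ.
      apply/gal_fixed_rational => tau; rewrite raddfB.
      have /eqP := Ea tau; rewrite [LHS]/= subr_eq => /eqP->.
      by rewrite addrC -addrA addKr addrC.
    have mP : val P \in sumgroup PQ PZ.
      by apply/asboolP; exists (val P - a), a; split=> //; rewrite subrK.
    by exists (Subgroup mP); apply: val_inj.
  case=> -[S mS] EP; apply/cE.
  have {}EP : val P = S by rewrite -EP.
  move: mS EP => /asboolP[R [a [/gal_fixed_rational RQ aZ ->]]] EP.
  exists a => // tau; rewrite -[LHS]/(act tau (val P) - val P) EP raddfD RQ.
  by rewrite opprD addrACA subrr add0r.
- elim/quotW => f; split.
    (* A cocycle that is the coboundary of a primitive point [a] is exactly [gal_diff] of [a]. *)
    rewrite H1_inclE => /class_of_eq0[a aprim Ea]; exists (Subgroup aprim).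
    by congr class_of; apply: val_inj; apply/funext => tau; rewrite [RHS]Ea.
  case=> P <-; rewrite [LHS]H1_inclE; apply/class_of_eq0.
  by exists (val P); first exact: valP.
Qed.
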